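(* Let $\lambda$ be an infinite cardinal number such that $\lambda=\lambda^{\aleph_0}$. Then for every metric space $X$ of weight $\lambda$ there exist a Banach space $B$ of weight $\lambda$ and a bijective continuous mapping from $X$ onto $B$ (with its norm topology).
   Context: The weight of a topological space is the least cardinality of a base of its topology; the weight of a metric (or Banach) space is the weight of the topology induced by its metric (or norm). *)

(* Defs.v *)
From mathcomp Require Import all_boot all_order all_algebra.
From mathcomp Require Import all_classical all_reals all_analysis.

Set Implicit Arguments.
Unset Strict Implicit.
Unset Printing Implicit Defensive.

Local Open Scope classical_set_scope.
Local Open Scope card_scope.

(* A cardinal number is represented by a type L of that cardinality, so that
   its power to aleph_0 is the cardinality of [set: nat -> L]. *)
Definition has_weight (T : topologicalType) (L : Type) : Prop :=
  (exists2 B : set_system T, basis B & B #= [set: L]) /\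
  (forall B : set_system T, basis B -> [set: L] #<= B).

(* Main.v *)
Require Import Defs.
From HB Require Import structures.
From mathcomp Require Import all_boot all_order all_algebra.
From mathcomp Require Import all_classical all_reals all_analysis.
From mathcomp Require Import lra.

(* The target is B = c_0(nat * X), whose coordinates are grouped into levels
   n : nat.  Tents of radius 1/(n+1) around the points of a well-ordered X, each
   diminished by the supremum of the earlier ones, give a Lipschitz map
   [code : X -> B] that is injective even modulo finitely many levels.
   Since |L|^aleph_0 = |L|, Koenig's theorem yields an e-separated family
   (d_i) indexed by i : L * nat.  For any targets b_i the code can be bent near
   each d_i so that d_i is sent to b_i, every other point keeping all but
   finitely many levels of its code.  Continuity holds because elements of
   c_0 have small tails.  Points outside the d_i thus stay separated, and it
   remains to choose the b_i so that they enumerate exactly the points of B not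
   taken by the others.  Whether y in B, with the same tail as code x, is taken
   depends only on the one d_i near x; hence the b_i with i of rank n+1 can
   enumerate the points missed because of those of rank n, and the b_i of rank 0
   the points that have the tail of no code. *)

Set Implicit Arguments.
Unset Strict Implicit.
Unset Printing Implicit Defensive.

Import Order.TTheory GRing.Theory Num.Theory.
Import numFieldNormedType.Exports.
Local Open Scope classical_set_scope.
Local Open Scope ring_scope.
Local Open Scope card_scope.

(** * The Banach space $c_0(I)$ with the supremum norm *)

Section c0_space.
Context (R : realType) (I : choiceType).

Definition vanishing : {pred I -> R^o} :=
  fun g => `[< forall e : R, 0 < e -> finite_set [set i | e <= `|g i|] >].

Lemma vanishing_submod_closed : submod_closed vanishing.
Proof.
split=> [|a g k /asboolP vg /asboolP vk]; apply/asboolP => e e0.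
  apply: (sub_finite_set _ (finite_set0 _)) => i /=.
  by rewrite normr0 leNgt e0.
have e2 : 0 < e / 2 by lra.
have a1 : 0 < `|a| + 1 by rewrite ltr_wpDl.
have ea : 0 < e / 2 / (`|a| + 1) by rewrite divr_gt0.
have fU : finite_set ([set i | e / 2 / (`|a| + 1) <= `|g i|] `|`
                      [set i | e / 2 <= `|k i|]).
  by rewrite finite_setU; split; [exact: vg|exact: vk].
apply: (sub_finite_set _ fU) => i /= eagk.
case: (leP (e / 2) `|k i|) => [|ki]; [by right|left].
rewrite /= ler_pdivrMr//.
have : `|(a *: g + k) i| <= `|a| * `|g i| + `|k i|.
  by rewrite (le_trans (ler_normD _ _))// normrM.
have := normr_ge0 (g i); nra.
Qed.

HB.instance Definition _ :=
  GRing.isSubmodClosed.Build R (I -> R^o) vanishing vanishing_submod_closed.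

Record c0 := C0 { c0_val :> I -> R^o ; _ : c0_val \in vanishing }.

HB.instance Definition _ := [isSub for c0_val].
HB.instance Definition _ := [Choice of c0 by <:].
HB.instance Definition _ := [SubChoice_isSubLmodule of c0 by <:].

Lemma c0P (g : c0) (e : R) : 0 < e -> finite_set [set i | e <= `|g i|].
Proof. by case: g => g /= /asboolP; exact. Qed.

Lemma c0E (g k : c0) : (forall i, g i = k i) -> g = k.
Proof. by move=> gk; apply/val_inj/funext. Qed.

Lemma c0D (g k : c0) i : (g + k) i = g i + k i. Proof. by []. Qed.
Lemma c0B (g k : c0) i : (g - k) i = g i - k i. Proof. by []. Qed.
Lemma c0Z a (g : c0) i : (a *: g) i = a * g i. Proof. by []. Qed.

Definition c0_norm (g : c0) : R := sup (range (fun i => `|g i|)).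

Lemma c0_has_ubound (g : c0) : has_ubound (range (fun i => `|g i|)).
Proof.
have /finite_seqP[s gs] := c0P g ltr01.
exists (\big[Num.max/1]_(i <- s) `|g i|) => _ [i _ <-].
have [gi|gi] := ltP `|g i| 1.
  by rewrite (le_trans (ltW gi))// bigmax_ge_id.
have : i \in s by have : [set` s] i by rewrite -gs.
move=> si.
exact: (@Order.TotalTheory.le_bigmax_seq _ R I s 1 i xpredT (fun i => `|g i|)).
Qed.

Lemma c0_norm_ge (g : c0) i : `|g i| <= c0_norm g.
Proof. by apply: ub_le_sup; [exact: c0_has_ubound|exists i]. Qed.

Lemma c0_norm_le (g : c0) (M : R) :
  0 <= M -> (forall i, `|g i| <= M) -> c0_norm g <= M.
Proof.
move=> M0 gM; rewrite /c0_norm.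
have [->|/set0P gN0] := eqVneq (range (fun i => `|g i|)) set0.
  by rewrite sup0.
by apply: ge_sup => // _ [i _ <-].
Qed.

Lemma c0_norm_ge0 (g : c0) : 0 <= c0_norm g.
Proof.
rewrite /c0_norm; have [->|/set0P[_ [i _ _]]] :=
  eqVneq (range (fun i => `|g i|)) set0; first by rewrite sup0.
exact: le_trans (normr_ge0 _) (c0_norm_ge g i).
Qed.

Lemma c0_ler_normD (g k : c0) : c0_norm (g + k) <= c0_norm g + c0_norm k.
Proof.
apply: c0_norm_le => [|i]; first by rewrite addr_ge0 ?c0_norm_ge0.
by rewrite c0D (le_trans (ler_normD _ _))// lerD ?c0_norm_ge.
Qed.

Lemma c0_normrZ (a : R) (g : c0) : c0_norm (a *: g) = `|a| * c0_norm g.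
Proof.
apply/eqP; rewrite eq_le; apply/andP; split.
  apply: c0_norm_le => [|i]; first by rewrite mulr_ge0 ?c0_norm_ge0.
  by rewrite c0Z normrM ler_wpM2l ?c0_norm_ge.
have [->|a0] := eqVneq a 0; first by rewrite normr0 mul0r c0_norm_ge0.
rewrite -ler_pdivlMl ?normr_gt0// c0_norm_le// => [|i].
  by rewrite mulr_ge0 ?invr_ge0 ?c0_norm_ge0.
by rewrite ler_pdivlMl ?normr_gt0// -normrM -c0Z c0_norm_ge.
Qed.

Lemma c0_normr0_eq0 (g : c0) : c0_norm g = 0 -> g = 0.
Proof.
move=> g0; apply: c0E => i; apply/eqP.
by rewrite -[_ == _]normr_eq0 eq_le normr_ge0 andbT -g0 c0_norm_ge.
Qed.

HB.instance Definition _ := Lmodule_isNormed.Build R c0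
  c0_ler_normD c0_normrZ c0_normr0_eq0.

Lemma c0_normr_ge (g : c0) i : `|g i| <= `|g|.
Proof. exact: c0_norm_ge. Qed.

Lemma c0_normr_le (g : c0) (M : R) :
  0 <= M -> (forall i, `|g i| <= M) -> `|g| <= M.
Proof. exact: c0_norm_le. Qed.

(** Limits are taken coordinatewise. If the filter contains the [e]-ball around [g], the limit is
    within [e] of [g] at all coordinates at once; this gives both its vanishing and the convergence
    in norm. *)
Lemma c0_complete (F : set_system c0) : ProperFilter F -> cauchy F -> cvg F.
Proof.
move=> FF /cauchyP Fc.
have lP i : cvg ((fun g : c0 => (g i : R)) @ F).
  apply: cauchy_cvg; apply/cauchyP => e e0.
  have [g gF] := Fc e e0; exists (g i); apply: (@filterS _ F _ _ _ _ gF) => k.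
  rewrite -!ball_normE /= => gk; apply: le_lt_trans gk.
  exact: c0_normr_ge (g - k) i.
pose l i : R := lim ((fun g : c0 => (g i : R)) @ F).
have lgF e (g : c0) i : F (ball g e) -> `|l i - g i| <= e.
  move=> gF; rewrite distrC.
  have : (fun k : c0 => `|(g i : R) - (k i : R)|) @ F --> `|(g i : R) - l i|.
    by apply: cvg_norm; apply: cvgB; [exact: cvg_cst|exact: lP].
  move=> /cvgr_to_le; apply; apply: (@filterS _ F _ _ _ _ gF) => k.
  rewrite -ball_normE /= => /ltW; apply: le_trans.
  exact: c0_normr_ge (g - k) i.
have lv : (l : I -> R^o) \in vanishing.
  apply/asboolP => e e0; have e2 : 0 < e / 2 by lra.
  have [g gF] := Fc _ e2; apply: sub_finite_set (c0P g e2) => i /= ei.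
  have := lgF _ _ i gF; have := ler_normD (l i - g i) (g i).
  rewrite subrK => ? ?; lra.
apply/cvg_ex; exists (C0 lv); apply/cvgrPdist_le => e e0.
have e2 : 0 < e / 2 by lra.
have [g gF] := Fc _ e2; apply: (@filterS _ F _ _ _ _ gF) => k.
rewrite -ball_normE /= => gk; apply: c0_normr_le; first exact: ltW.
move=> i; rewrite c0B /=; have := lgF _ _ i gF.
have := ler_normD (l i - g i) (g i - k i); rewrite addrA subrK.
have := c0_normr_ge (g - k) i; rewrite c0B => ? ? ?; lra.
Qed.

HB.instance Definition _ := Uniform_isComplete.Build c0 c0_complete.

End c0_space.

(** * Cardinal comparison and Koenig's theorem *)

Lemma invS_lt (R : realType) (r : R) : 0 < r -> exists n, n.+1%:R^-1 < r.
Proof.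
move=> r0; exists (Num.truncn r^-1).
by rewrite -[ltRHS]invrK ltf_pV2 ?posrE ?invr_gt0// truncnS_gt.
Qed.

Lemma card_leT_setP (T U : Type) (S : set U) :
  [set: T] #<= S <-> exists2 f : T -> U, injective f & forall t, S (f t).
Proof.
split=> [|[f f_inj fS]].
  move=> /card_leP[f]; exists (fun t => set_val (f (to_setT t))) => [s t|t].
    move=> /val_inj fst; have := @inj _ _ _ f (to_setT s) (to_setT t).
    by rewrite !inE => /(_ I I fst)/(congr1 val).
  exact: set_valP.
have fT : f @` [set: T] #= [set: T] by apply: inj_card_eq => s t _ _ /f_inj.
rewrite -(card_le_eql fT); apply: subset_card_le => _ [t _ <-]; exact: fS.
Qed.

Lemma card_leTTP (T U : Type) :
  [set: T] #<= [set: U] <-> exists f : T -> U, injective f.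
Proof.
by rewrite card_leT_setP; split=> [[f]|[f]]; exists f.
Qed.

Lemma card_eq_range (T U : Type) (S : set U) :
  [set: T] #= S -> exists2 f : T -> U, injective f & range f = S.
Proof.
move=> /card_eqP[f].
exists (fun t => set_val (f (to_setT t))) => [s t|].
  move=> /val_inj fst; have := @inj _ _ _ f (to_setT s) (to_setT t).
  by rewrite !inE => /(_ I I fst)/(congr1 val).
apply/seteqP; split=> [_ [t _ <-]|u Su]; first exact: set_valP.
have [t _ ft] := @surj _ _ _ _ f (SigSub (mem_set Su)) I.
by exists (set_val t) => //; rewrite (_ : to_setT _ = t) ?ft//; exact: val_inj.
Qed.

(* Koenig's theorem, by diagonalization against the surjection [phi] *)
Lemma card_le_cover (L : Type) (phi : L -> nat -> L) (A : nat -> set L) :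
  (forall u, exists a, phi a = u) -> \bigcup_n A n = [set: L] ->
  exists n, [set: L] #<= A n.
Proof.
move=> phi_surj AT; apply: contrapT => /forallNP nA.
(* Otherwise [phi a n], for [a] in [A n], would take every value in [L], and choosing preimages
   would inject [L] into [A n]. *)
have /choice[u uP] n : exists s, forall a, A n a -> phi a n <> s.
  apply: contrapT => /forallNP h; apply: (nA n); apply/card_leT_setP.
  have /choice[g gP] s : exists a, A n a /\ phi a n = s.
    by have /existsNP[a /not_implyP[Aa /contrapT]] := h s; exists a.
  exists g => [s t gst|s]; last by case: (gP s).
  by rewrite -(gP s).2 -(gP t).2 gst.
have [a phia] := phi_surj u.
have : (\bigcup_n A n) a by rewrite AT.
by move=> [n _ Ana]; apply: (uP n a Ana); rewrite phia.
Qed.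

(** * Cardinal arithmetic from $\lambda^{\aleph_0} \le \lambda$ *)

Section countable_power.
Context (L : Type) (L_infinite : infinite_set [set: L]).
Context (L_power : [set: nat -> L] #<= [set: L]).

Lemma card_le_power (T : Type) :
  [set: T] #<= [set: L] -> [set: nat -> T] #<= [set: L].
Proof.
move=> /card_leTTP[f f_inj]; apply: card_le_trans L_power.
apply/card_leTTP; exists (fun u => f \o u) => u v uv.
by apply/funext => n; apply: f_inj; have := congr1 (@^~ n) uv.
Qed.

Lemma card_le_nat : [set: nat] #<= [set: L].
Proof. exact/infiniteP. Qed.

Lemma card_le_prod (T U : Type) : [set: T] #<= [set: L] ->
  [set: U] #<= [set: L] -> [set: T * U] #<= [set: L].
Proof.
move=> /card_leTTP[f f_inj] /card_leTTP[g g_inj]; apply: card_le_trans L_power.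
apply/card_leTTP.
exists (fun x n => if n is 0%N then f x.1 else g x.2) => -[a b] [a' b'] /= ab.
congr (_, _); first exact/f_inj/(congr1 (@^~ 0%N) ab).
exact/g_inj/(congr1 (@^~ 1%N) ab).
Qed.

(** A real is determined by its Dedekind cut, hence by a sequence of booleans indexed by codes of
    rationals. *)
Lemma card_le_real (R : realType) : [set: R] #<= [set: L].
Proof.
have [g g_inj] : exists g : bool -> L, injective g.
  have /card_leTTP[f f_inj] := card_le_nat.
  by exists (fun b => f (nat_of_bool b)) => -[] [] // /f_inj.
apply: (@card_le_trans _ _ _ [set: nat -> bool]); last first.
  by apply: card_le_power; apply/card_leTTP; exists g.
apply/card_leTTP.
exists (fun (r : R) n => if unpickle n is Some q then ratr q < r else false).
move=> r s rs; apply/eqP; rewrite eq_le !leNgt; apply/andP; split; apply/negP.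
  move=> /rat_in_itvoo[q]; rewrite in_itv /= => /andP[sq qr].
  have /= := congr1 (@^~ (pickle q)) rs; rewrite pickleK qr => /esym.
  by rewrite (lt_gtF sq).
move=> /rat_in_itvoo[q]; rewrite in_itv /= => /andP[rq qs].
have /= := congr1 (@^~ (pickle q)) rs; rewrite pickleK qs.
by rewrite (lt_gtF rq).
Qed.

(** Supports are countable, so an element is determined by a sequence of pairs (index, value) that
    runs through its support. *)
Lemma card_le_c0 (R : realType) (K : choiceType) (k0 : K) :
  [set: K] #<= [set: L] -> [set: c0 R K] #<= [set: L].
Proof.
move=> KL.
apply: card_le_trans (card_le_power (card_le_prod KL (card_le_real R))).
have /choice[e eP] (g : c0 R K) : exists e : nat -> K,
    forall i, g i != 0 -> exists n, e n = i.
  have : countable [set i | g i != 0].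
    rewrite (_ : [set i | _] = \bigcup_n [set i | n.+1%:R^-1 <= `|g i|]).
      apply: bigcup_countable => // n _; apply: finite_set_countable.
      by apply: c0P; rewrite invr_gt0.
    apply/seteqP; split=> i /= => [gi0|[n _]]; last first.
      by rewrite -normr_gt0; apply: lt_le_trans; rewrite invr_gt0.
    have [n ngi] : exists n, n.+1%:R^-1 < `|g i|.
      by apply: invS_lt; rewrite normr_gt0.
    by exists n => //; exact: ltW.
  move=> /countable_injP[h h_inj].
  (* [e] inverts the numbering [h] of the support, with default [k0] at numbers that are not
     attained. *)
  have /choice[e eP] n : exists i, forall j, g j != 0 -> h j = n -> i = j.
    have [[i [gi hi]]|/forallNP nI] := pselect (exists i, g i != 0 /\ h i = n).
      by exists i => j gj hj; apply: h_inj; rewrite ?inE ?hi ?hj.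
    by exists k0 => j gj hj; case: (nI j).
  by exists e => i gi; exists (h i); apply: eP.
apply/card_leTTP; exists (fun g n => (e g n, g (e g n) : R)) => g k gk.
have gke n : e g n = e k n /\ g (e g n) = k (e k n) :> R.
  by have := congr1 (@^~ n) gk => -[].
apply: c0E => i; have [gi|/eP[n <-]] := eqVneq (g i) 0; last first.
  by have [egk ->] := gke n; rewrite egk.
have [ki|/eP[n eki]] := eqVneq (k i) 0; first by rewrite gi ki.
by have [egk gkn] := gke n; rewrite -{2}eki -gkn egk eki.
Qed.
End countable_power.

(** Base sets chosen between the points [d a] and their [e]-balls are pairwise distinct, which
    bounds every base from below; balls of radius $1/(n+1)$ around all points supply a base that is
    small enough. *)
Lemma has_weight_separated (R : realType) (T : pseudoMetricType R) (L : Type)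
    (d : L -> T) (e : R) :
  0 < e -> (forall a b, a <> b -> ~ ball (d a) e (d b)) ->
  [set: nat * T] #<= [set: L] -> has_weight T L.
Proof.
move=> e0 d_sep TL.
have lowB (B : set_system T) : basis B -> [set: L] #<= B.
  move=> [_ Bb]; apply/card_leT_setP.
  have /choice[U UP] a : exists U, [/\ B U, U (d a) & U `<=` ball (d a) e].
    have /Bb[U [BU Uda] Ue] : nbhs (d a) (ball (d a) e) by exact: nbhsx_ballx.
    by exists U.
  exists U => [a b Uab|a]; last by case: (UP a).
  apply: contrapT => /d_sep; apply.
  by have [_ _] := UP a; apply; rewrite Uab; case: (UP b).
(* Interiors are taken because balls of a pseudometric structure may fail to be open. *)
split=> //; pose V (w : nat * T) := (ball w.2 (w.1.+1%:R^-1 : R))°.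
have bV : basis (range V).
  split=> [_ [w _ <-]|x]; first exact: open_interior.
  move=> A /nbhs_ballP[r /= r0 xrA].
  have [n nr] := invS_lt r0; exists (V (n, x)) => /=.
    split; first by exists (n, x).
    by apply: nbhsx_ballx; rewrite invr_gt0.
  move=> y /interior_subset; rewrite /= => xy; apply: xrA.
  exact: le_ball (ltW nr) _ xy.
exists (range V) => //; rewrite card_eq_le lowB// andbT.
by apply: card_le_trans TL; exact: card_image_le.
Qed.

(** * Cardinality and separated families in metric spaces *)

Section metric.
Context (R : realType) (X : metricType R) (L : Type).

(* [mdist] takes values in the numDomainType underlying [R]; retyping it in [R]
   is what lets [lra] see a realFieldType. *)
Definition rdist (x y : X) : R := mdist x y.

Lemma ball_rdistE (x : X) (r : R) : ball x r = [set y | rdist x y < r].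
Proof. exact: ballEmdist. Qed.

Lemma rdist_triangle (x y z : X) : rdist x z <= rdist x y + rdist y z.
Proof. exact: metric_triangle. Qed.

Lemma rdistC (x y : X) : rdist x y = rdist y x.
Proof. exact: metric_sym. Qed.

Lemma rdistxx (x : X) : rdist x x = 0.
Proof. exact: mdistxx. Qed.

Lemma rdist_ge0 (x y : X) : 0 <= rdist x y.
Proof. exact: mdist_ge0. Qed.

Lemma rdist_eq0 (x y : X) : rdist x y = 0 -> x = y.
Proof. exact: mdist_positivity. Qed.

Lemma nbhs_rdistP (x : X) (A : set X) :
  nbhs x A <-> exists2 r : R, 0 < r & forall y, rdist x y < r -> A y.
Proof.
split=> [/nbhs_ballP[r r0 xrA]|[r r0 xrA]].
  by exists r => // y xy; apply: xrA; rewrite ball_rdistE.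
by apply/nbhs_ballP; exists r => // y; rewrite ball_rdistE; exact: xrA.
Qed.

Lemma ball_open_metric (x : X) (r : R) : open (ball x r).
Proof.
rewrite openE => y; rewrite ball_rdistE /= => xy; apply/nbhs_rdistP.
exists (r - rdist x y); first by rewrite subr_gt0.
move=> z yz /=; have := rdist_triangle x y z; lra.
Qed.

(** A point is determined by a sequence of base sets that contain it and lie in its balls of radius
    $1/(n+1)$. *)
Lemma card_le_weight (Bs : set_system X) : basis Bs -> Bs #<= [set: L] ->
  [set: nat -> L] #<= [set: L] -> [set: X] #<= [set: L].
Proof.
move=> [_ Bb] BL; apply: card_le_trans.
apply: (@card_le_trans _ _ _ [set: nat -> Bs]); last first.
  have /card_leTTP[f f_inj] : [set: Bs] #<= [set: L].
    by rewrite (card_le_eql (card_setT _)).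
  apply/card_leTTP; exists (fun u => f \o u) => u v uv.
  by apply/funext => n; apply: f_inj; have := congr1 (@^~ n) uv.
apply/card_leTTP.
have /choice[U UP] (w : X * nat) : exists U : Bs,
    set_val U w.1 /\ set_val U `<=` ball w.1 (w.2.+1%:R^-1 : R).
  have /Bb[U [BU Ux] Ue] : nbhs w.1 (ball w.1 (w.2.+1%:R^-1 : R)).
    by apply: nbhsx_ballx; rewrite invr_gt0.
  by exists (SigSub (mem_set BU)).
exists (fun x n => U (x, n)) => x y xy; apply: rdist_eq0; apply/eqP.
rewrite eq_le rdist_ge0 andbT leNgt; apply/negP => /invS_lt[n nxy].
have [_ /(_ y)] := UP (x, n); have [yU _] := UP (y, n).
rewrite (congr1 (@^~ n) xy) => /(_ yU) /=; rewrite ball_rdistE /= => xyn.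
by have := lt_trans nxy xyn; rewrite ltxx.
Qed.

(** Zorn's lemma: a point at distance at least [r] from a maximal separated set could be added to
    it. *)
Lemma maximal_separated (r : R) : 0 < r -> exists D : set X,
  (forall x y, D x -> D y -> x <> y -> r <= rdist x y) /\
  (forall x, exists2 y, D y & rdist x y < r).
Proof.
move=> r0.
pose P := [set D : set X | forall x y, D x -> D y -> x <> y -> r <= rdist x y].
have [|D [PD Dmax]] := @Zorn_bigcup X P.
  move=> F FP Ftot x y [A FA Ax] [B FB By].
  by have [/(_ x Ax) Bx|/(_ y By) Ay] := Ftot _ _ FA FB;
    [exact: FP FB _ _ Bx By|exact: FP FA _ _ Ax Ay].
exists D; split=> // x; apply: contrapT => /forall2NP xD.
have {}xD y : D y -> r <= rdist x y.
  by move=> Dy; have [//|/negP] := xD y; rewrite -leNgt.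
have Dx : ~ D x by move=> /xD; rewrite rdistxx leNgt r0.
apply: (Dmax (x |` D)); first split=> [y Dy|/(_ x)]; first by right.
  by move=> /(_ (or_introl erefl)).
move=> y z [->|Dy] [->|Dz] //; [|rewrite rdistC|exact: PD].
  by move=> _; exact: xD.
by move=> _; exact: xD.
Qed.

(** The balls of radius $1/(n+1)$ around maximal $1/(n+1)$-separated sets, for all [n], form a base,
    so there are at least $|L|$ pairs of a level and a centre; by Koenig's theorem a single [n]
    already accounts for $|L|$ of them. *)
Lemma separated_weight (phi : L -> nat -> L) :
  (forall u, exists a, phi a = u) ->
  (forall Bs : set_system X, basis Bs -> [set: L] #<= Bs) ->
  exists e : R, 0 < e /\ exists d : L -> X, forall a b, a <> b ->
    e <= rdist (d a) (d b).
Proof.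
move=> phi_surj lowX.
have r0 n : 0 < n.+1%:R^-1 :> R by rewrite invr_gt0.
have /choice[D DP] n := maximal_separated (r0 n).
pose W := [set w : nat * X | D w.1 w.2].
pose V (w : nat * X) := ball w.2 (w.1.+1%:R^-1 : R).
have bV : basis (V @` W).
  split=> [_ [w _ <-]|x A /nbhs_rdistP[r rgt0 xrA]].
    exact: ball_open_metric.
  have [n nr] : exists n, n.+1%:R^-1 < r / 2 by apply: invS_lt; lra.
  have [_ /(_ x)[s Ds xs]] := DP n; exists (V (n, s)); rewrite /V /=.
    by split; [exists (n, s)|rewrite ball_rdistE /= rdistC].
  move=> y; rewrite ball_rdistE /= => sy; apply: xrA.
  have := rdist_triangle x s y.
  by have := lt_trans xs nr; have := lt_trans sy nr; lra.
have /card_leT_setP[k k_inj kW] : [set: L] #<= W.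
  exact: card_le_trans (lowX _ bV) (card_image_le _ _).
have [|n /card_leT_setP[v v_inj vn]] :=
  card_le_cover phi_surj (A := fun n => [set a | (k a).1 = n]).
  by apply/seteqP; split=> // a _; exists (k a).1.
exists n.+1%:R^-1; split=> //; exists (fun a => (k (v a)).2) => a b ab.
have kvE c : k (v c) = (n, (k (v c)).2).
  by rewrite [LHS]surjective_pairing; congr (_, _); exact: vn.
have [Dsep _] := DP n; apply: Dsep.
- by have := kW (v a); rewrite /W /= kvE.
- by have := kW (v b); rewrite /W /= kvE.
- by move=> kab; apply/ab/v_inj/k_inj; rewrite kvE kab -kvE.
Qed.
End metric.

(** * The Lipschitz code of a metric space in $c_0$ *)

Section code.
Context (R : realType) (X : metricType R).
Implicit Types (r e : R) (s t x y : X).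

Definition wo_lt (s t : X) : bool :=
  (s != t) && sval (wochoice.well_ordering_principle X) s t.

Lemma wo_lt_total (s t : X) : s != t -> wo_lt s t || wo_lt t s.
Proof.
rewrite /wo_lt; case: wochoice.well_ordering_principle => /= W Wwo st.
have Wtot : {in predT &, total W}.
  by apply: wochoice.wo_chainW => A _; exact: Wwo.
by rewrite st eq_sym st /=; exact: Wtot.
Qed.

Lemma wo_lt_least (A : set X) : A !=set0 ->
  exists2 s, A s & forall t, wo_lt t s -> ~ A t.
Proof.
move=> [a Aa]; rewrite /wo_lt.
case: wochoice.well_ordering_principle => /= W Wwo.
have [|s [[As sA] _]] := Wwo (mem A); first by exists a; rewrite inE.
exists s => [|t /andP[ts Wts] At]; first by rewrite inE in As.
have Wanti : {in predT &, antisymmetric W}.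
  by apply: wochoice.wo_chain_antisymmetric => B _; exact: Wwo.
have Wst : W s t by apply: sA; rewrite inE.
by move/eqP: ts; apply; apply: Wanti => //; rewrite Wts.
Qed.

Definition tent (r : R) (s x : X) : R := Num.max 0 (r - rdist x s).

(** The supremum of the empty set is 0, so nothing is subtracted at the least point. *)
Definition tent_before (r : R) (s x : X) : R :=
  sup [set tent r t x | t in [set t | wo_lt t s]].

Definition excess (r : R) (s x : X) : R :=
  Num.max 0 (tent r s x - tent_before r s x).

Lemma tent_ge0 r s x : 0 <= tent r s x.
Proof. by rewrite le_max lexx. Qed.

Lemma tent_le r s x : 0 <= r -> tent r s x <= r.
Proof.
by move=> r0; rewrite /tent; have := rdist_ge0 x s; rewrite ge_max; lra.
Qed.

Lemma tent_lip r s x y : tent r s x <= tent r s y + rdist x y.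
Proof.
rewrite /tent; have := rdist_triangle y x s; rewrite (rdistC y x).
have := rdist_ge0 x y.
case: (lerP 0 (r - rdist x s)); case: (lerP 0 (r - rdist y s)); lra.
Qed.

Lemma tent_le_before r s t x : 0 <= r -> wo_lt t s ->
  tent r t x <= tent_before r s x.
Proof.
move=> r0 ts; apply: ub_le_sup; last by exists t.
by exists r => _ [a _ <-]; exact: tent_le.
Qed.

Lemma tent_before_le r s x M : 0 <= M ->
  (forall t, wo_lt t s -> tent r t x <= M) -> tent_before r s x <= M.
Proof.
move=> M0 tM; rewrite /tent_before; set B := (X in sup X).
have [->|/set0P BN0] := eqVneq B set0; first by rewrite sup0.
by apply: ge_sup => // _ [t ts <-]; exact: tM.
Qed.

Lemma tent_before_ge0 r s x : 0 <= r -> 0 <= tent_before r s x.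
Proof.
move=> r0; rewrite /tent_before; set B := (X in sup X).
have [->|/set0P[_ [t ts _]]] := eqVneq B set0; first by rewrite sup0.
exact: le_trans (tent_ge0 r t x) (tent_le_before x r0 ts).
Qed.

Lemma tent_before_lip r s x y : 0 <= r ->
  tent_before r s x <= tent_before r s y + rdist x y.
Proof.
move=> r0; apply: tent_before_le => [|t ts].
  by rewrite addr_ge0 ?tent_before_ge0 ?rdist_ge0.
by have := tent_le_before y r0 ts; have := tent_lip r t x y; lra.
Qed.

Lemma excess_ge0 r s x : 0 <= excess r s x.
Proof. by rewrite le_max lexx. Qed.

Lemma excess_le r s x : 0 <= r -> excess r s x <= r.
Proof.
move=> r0; have := tent_le s x r0; have := tent_before_ge0 s x r0.
by rewrite /excess; case: (lerP 0 (tent r s x - tent_before r s x)); lra.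
Qed.

(** The tent and the supremum of the earlier tents each contribute a Lipschitz constant 1, and the
    positive part does not increase it. *)
Lemma excess_lip r s x y : 0 <= r ->
  `|excess r s x - excess r s y| <= 2 * rdist x y.
Proof.
move=> r0; rewrite ler_norml /excess.
have := tent_lip r s x y; have := tent_lip r s y x.
have := tent_before_lip s x y r0; have := tent_before_lip s y x r0.
have := rdist_ge0 x y; rewrite (rdistC y x).
case: (lerP 0 (tent r s x - _)); case: (lerP 0 (tent r s y - _)); lra.
Qed.

(* In the well-order, successive points of the set increase the tent at [x] by
   at least [e], while tents are bounded by [r]. *)
Lemma excess_finite r x (e : R) : 0 <= r -> 0 < e ->
  finite_set [set s | e <= excess r s x].
Proof.
move=> r0 e0; set A := [set s | _].
have AP s t : A s -> wo_lt t s -> e + tent r t x <= tent r s x.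
  rewrite /A /= /excess => es /(tent_le_before x r0).
  by move: es; case: (lerP 0 (tent r s x - _)); lra.
(* Rounding down turns steps of size [e] into strict growth of integers bounded by [r / e]. *)
pose f s := Num.truncn (tent r s x / e).
have f_lt s t : A s -> wo_lt t s -> (f t < f s)%N.
  move=> As /(AP _ _ As) ets; rewrite /f truncn_gt_nat.
  have : (f t)%:R <= tent r t x / e.
    by rewrite truncn_le divr_ge0 ?tent_ge0 ?(ltW e0).
  by rewrite ler_pdivlMr// -natr1 ler_pdivlMr// mulrDl mul1r; lra.
have f_inj : {in A &, injective f}.
  move=> s t; rewrite !inE => As At; apply: contraPP => /eqP /wo_lt_total/orP[].
    by move=> /(f_lt _ _ At) /[swap] ->; rewrite ltnn.
  by move=> /(f_lt _ _ As) /[swap] ->; rewrite ltnn.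
rewrite -(eq_finite_set (inj_card_eq f_inj)).
apply: (@sub_finite_set _ _ `I_(Num.truncn (r / e)).+1); last exact: finite_II.
move=> _ [s _ <-] /=; rewrite ltnS truncn_ge_nat ?divr_ge0 ?(ltW e0)//.
rewrite (@le_trans _ _ (tent r s x / e))//.
  by rewrite truncn_le divr_ge0 ?tent_ge0 ?(ltW e0).
by rewrite ler_pM2r ?invr_gt0// tent_le.
Qed.

(** Let [s] be least with a nonzero tent at [x]: there its excess is the whole tent. An equal excess
    at [y] would put both points within [r] of [s]. *)
Lemma excess_separates r x y : 0 < r -> 2 * r < rdist x y ->
  exists s, excess r s x != excess r s y.
Proof.
move=> r0 rxy.
have tent0 s z : tent r s z != 0 -> rdist z s < r.
  move=> t0; have : 0 < tent r s z by rewrite lt_neqAle eq_sym t0 tent_ge0.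
  by rewrite /tent lt_max ltxx subr_gt0.
have [s sx sA] : exists2 s, tent r s x != 0 &
    forall t, wo_lt t s -> ~ (tent r t x != 0).
  apply: (@wo_lt_least [set s | tent r s x != 0]); exists x => /=.
  by rewrite /tent rdistxx subr0 gt_eqF// lt_max r0 orbT.
have before0 : tent_before r s x = 0.
  apply/eqP; rewrite eq_le tent_before_ge0 ?andbT ?(ltW r0)//.
  apply: tent_before_le => // t /sA/negP; rewrite negbK => /eqP ->.
  exact: lexx.
exists s; apply/eqP => exy.
have ex : excess r s x = tent r s x.
  by rewrite /excess before0 subr0 max_r// tent_ge0.
have ey : 0 < excess r s y by rewrite -exy ex lt_neqAle eq_sym sx tent_ge0.
have yt : 0 < tent r s y.
  have := tent_before_ge0 s y (ltW r0); move: ey; rewrite /excess.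
  by case: (lerP 0 (tent r s y - tent_before r s y)); lra.
have ys : rdist y s < r by apply: tent0; rewrite gt_eqF.
have := tent0 _ _ sx; have := rdist_triangle x s y; rewrite (rdistC s y); lra.
Qed.

(** Level [n] is bounded by $1/(n+1)$, so only finitely many levels reach [e], each at finitely many
    points. *)
Lemma code_vanishing x :
  (fun i : nat * X => excess i.1.+1%:R^-1 i.2 x : R^o)
    \in @vanishing R (nat * X)%type.
Proof.
apply/asboolP => e e0; have [N Ne] := invS_lt e0.
have fin :
    finite_set (`I_N `*`` (fun n => [set s | e <= excess n.+1%:R^-1 s x])).
  apply: finite_setXR; first exact: finite_II.
  by move=> n _; apply: excess_finite.
apply: (sub_finite_set _ fin) => -[n s] /=.
rewrite ger0_norm ?excess_ge0// => ens; split=> //=.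
rewrite ltnNge; apply/negP => Nn.
have : excess n.+1%:R^-1 s x <= n.+1%:R^-1.
  by apply: excess_le; rewrite invr_ge0.
have : n.+1%:R^-1 <= N.+1%:R^-1 :> R by rewrite lef_pV2 ?posrE// ler_nat.
move: Ne ens; set q : R := N.+1%:R^-1; set q' : R := n.+1%:R^-1; lra.
Qed.

Definition code x : c0 R (nat * X)%type := C0 (code_vanishing x).

Lemma code_le x n s : (code x (n, s) : R) <= n.+1%:R^-1.
Proof. by apply: excess_le; rewrite invr_ge0. Qed.

Lemma code_lip x y : `|code x - code y| <= 2 * rdist x y.
Proof.
apply: c0_normr_le => [|i]; first by rewrite mulr_ge0 ?rdist_ge0.
by rewrite c0B; apply: excess_lip; rewrite invr_ge0.
Qed.

(** Whole levels are disregarded, each with one coordinate per point of [X], since bending alters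
    whole levels. *)
Definition tail_eq (g k : c0 R (nat * X)%type) :=
  exists N, forall n s, (N <= n)%N -> g (n, s) = k (n, s).

Lemma tail_eq_sym g k : tail_eq g k -> tail_eq k g.
Proof. by move=> [N gk]; exists N => n s /gk ->. Qed.

Lemma tail_eq_trans g k l : tail_eq g k -> tail_eq k l -> tail_eq g l.
Proof.
move=> [N gk] [M kl]; exists (maxn N M) => n s.
by rewrite geq_max => /andP[/gk -> /kl ->].
Qed.

Lemma code_tail_inj x y : tail_eq (code x) (code y) -> x = y.
Proof.
move=> [N xy]; apply/rdist_eq0/eqP; rewrite eq_le rdist_ge0 andbT leNgt.
apply/negP => d0; have [M Md] : exists M, M.+1%:R^-1 < rdist x y / 2.
  by apply: invS_lt; lra.
set n := maxn N M.
have nd : 2 * n.+1%:R^-1 < rdist x y.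
  have : n.+1%:R^-1 <= M.+1%:R^-1 :> R.
    by rewrite lef_pV2 ?posrE// ler_nat ltnS leq_maxr.
  by move: Md; set q : R := n.+1%:R^-1; set q' : R := M.+1%:R^-1; lra.
have [|s /eqP] := @excess_separates n.+1%:R^-1 x y _ nd.
  by rewrite invr_gt0.
by apply; exact: xy n s (leq_maxl N M).
Qed.
End code.

(** * Levelwise damping in $c_0$ *)

Section damping.
Context (R : realType) (T : choiceType).
Local Notation K := (nat * T)%type.
Implicit Types (t : R) (g k : c0 R K).

(** For [t = 0] every level is kept; for [t] nonzero all levels with $(n+1)|t| \ge 1$ are erased. *)
Definition cutoff (n : nat) (t : R) : R := Num.max 0 (1 - n.+1%:R * `|t|).

Lemma cutoff_ge0 n t : 0 <= cutoff n t.
Proof. by rewrite le_max lexx. Qed.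

Lemma cutoff_le1 n t : cutoff n t <= 1.
Proof. by rewrite ge_max ler01 lerBlDr lerDl mulr_ge0. Qed.

Lemma cutoff0 n : cutoff n 0 = 1.
Proof. by rewrite /cutoff normr0 mulr0 subr0 max_r. Qed.

Lemma cutoff_eq0 n t : 1 <= n.+1%:R * `|t| -> cutoff n t = 0.
Proof. by move=> nt; rewrite /cutoff max_l// subr_le0. Qed.

Lemma cutoff_lip n t u : `|cutoff n t - cutoff n u| <= n.+1%:R * `|t - u|.
Proof.
have tu := ler_dist_dist t u; move: tu; rewrite ler_norml => /andP[tu ut].
have n0 : (0 : R) <= n.+1%:R by [].
have {}tu := ler_wpM2l n0 tu; have {}ut := ler_wpM2l n0 ut.
have := mulr_ge0 n0 (normr_ge0 (t - u)).
move: tu ut; rewrite mulrN mulrBr => tu ut tu0; rewrite ler_norml /cutoff.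
case: (lerP 0 (1 - n.+1%:R * `|t|)); case: (lerP 0 (1 - n.+1%:R * `|u|)); lra.
Qed.

Lemma damp_vanishing t g :
  (fun i : K => cutoff i.1 t * (g i : R) : R^o) \in @vanishing R K.
Proof.
apply/asboolP => e e0; apply: sub_finite_set (c0P g e0) => i /=.
move=> /le_trans; apply; rewrite normrM ler_piMl//.
by rewrite ger0_norm ?cutoff_ge0 ?cutoff_le1.
Qed.

Definition damp t g : c0 R K := C0 (damp_vanishing t g).

Lemma dampE t g n s : damp t g (n, s) = cutoff n t * (g (n, s) : R) :> R.
Proof. by []. Qed.

Lemma damp0 g : damp 0 g = g.
Proof. by apply: c0E => -[n s]; rewrite dampE cutoff0 mul1r. Qed.

Lemma dampB t g k : damp t (g - k) = damp t g - damp t k.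
Proof. by apply: c0E => -[n s]; rewrite c0B !dampE c0B mulrBr. Qed.

Lemma damp_ge1 t g : 1 <= t -> damp t g = 0.
Proof.
move=> t1; apply: c0E => -[n s]; rewrite dampE cutoff_eq0 ?mul0r//.
rewrite ger0_norm ?(le_trans ler01)// (le_trans t1)//.
by rewrite ler_peMl ?(le_trans ler01)// ler1n.
Qed.

Lemma damp_tail0 t g : t != 0 ->
  exists N, forall n s, (N <= n)%N -> damp t g (n, s) = 0 :> R.
Proof.
move=> t0; have [|N Nt] := @invS_lt R `|t|; first by rewrite normr_gt0.
exists N => n s Nn; rewrite dampE cutoff_eq0 ?mul0r//.
have : N.+1%:R * N.+1%:R^-1 <= n.+1%:R * `|t| :> R.
  by rewrite ler_pM ?invr_ge0 ?ler_nat ?ltnS// ltW.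
by rewrite divff.
Qed.

Lemma damp_norm t g : `|damp t g| <= `|g|.
Proof.
apply: c0_normr_le => // -[n s]; rewrite dampE normrM.
rewrite (le_trans _ (c0_normr_ge g (n, s)))// ler_piMl//.
by rewrite ger0_norm ?cutoff_ge0 ?cutoff_le1.
Qed.

(* The cutoffs are not equicontinuous in the level, but only finitely many
   levels of [g] exceed [e]. *)
Lemma damp_continuous t g (e : R) : 0 < e ->
  exists2 r : R, 0 < r & forall u, `|t - u| < r -> `|damp t g - damp u g| <= e.
Proof.
move=> e0; have e2 : 0 < e / 2 by lra.
have [N NP] : exists N, forall n s, e / 2 <= `|g (n, s)| -> (n < N)%N.
  have /finite_seqP[l lP] := finite_image fst (c0P g e2).
  exists (\max_(n <- l) n).+1 => n s gns; rewrite ltnS.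
  apply: leq_bigmax_seq => //.
  by have : [set` l] n by rewrite -lP; exists (n, s).
pose M := `|g| + 1; have M0 : 0 < M by rewrite ltr_wpDl.
(* On levels below [N] the cutoffs have Lipschitz constant at most [N.+1], and [M] bounds the
   coordinates of [g]. *)
exists (e / (N.+1%:R * M)) => [|u]; first by rewrite divr_gt0// mulr_gt0.
rewrite ltr_pdivlMr ?mulr_gt0// => tu.
apply: c0_normr_le => [|[n s]]; first exact: ltW.
rewrite c0B !dampE -mulrBl normrM; have [gns|gns] := leP (e / 2) `|g (n, s)|.
  have nN := NP _ _ gns; apply: le_trans (ltW tu); rewrite mulrA.
  apply: ler_pM => //.
    apply: le_trans (cutoff_lip n t u) _; rewrite mulrC ler_wpM2l//.
    by rewrite ler_nat ltnS ltnW.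
  by rewrite /M (le_trans (c0_normr_ge g (n, s)))// lerDl.
apply: (@le_trans _ _ (1 * `|g (n, s)|)); last by rewrite mul1r; lra.
rewrite ler_wpM2r// ler_norml.
have := cutoff_ge0 n t; have := cutoff_ge0 n u.
have := cutoff_le1 n t; have := cutoff_le1 n u; lra.
Qed.
End damping.

(** * Bending the code near a point *)

Section bending.
Context (R : realType) (X : metricType R) (C : R) (Cgt0 : 0 < C).
Local Notation B := (c0 R (nat * X)%type).
Implicit Types (d x y : X) (b : B).

(** [C] is the reciprocal of the radius beyond which the code is unchanged. *)
Definition bend d b x : B := code x + damp (C * rdist x d) (b - code x).

Lemma bend_center d b : bend d b d = b.
Proof. by rewrite /bend rdistxx mulr0 damp0 addrC subrK. Qed.

Lemma bend_far d b x : C^-1 <= rdist x d -> bend d b x = code x.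
Proof.
move=> xd; rewrite /bend damp_ge1 ?addr0//.
by rewrite -(mulfV (lt0r_neq0 Cgt0)) ler_pM2l.
Qed.

Lemma bend_tail d b x : x <> d -> tail_eq (bend d b x) (code x).
Proof.
move=> xd; have [|N NP] := @damp_tail0 _ _ (C * rdist x d) (b - code x).
  rewrite mulf_neq0 ?gt_eqF// lt_neqAle rdist_ge0 eq_sym andbT.
  by apply/eqP => /rdist_eq0.
by exists N => n s Nn; rewrite /bend c0D NP// addr0.
Qed.

Lemma bend_continuous d b : continuous (bend d b).
Proof.
move=> x; apply/cvgrPdist_le => e e0; apply/nbhs_rdistP.
have e2 : 0 < e / 2 by lra.
have [r r0 rP] := damp_continuous (C * rdist x d) (b - code x) e2.
(* The damping parameter moves at most [C] times the distance; the code enters twice with Lipschitz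
   constant 2, and [e / 8] keeps its total below [e / 2]. *)
exists (Num.min (r / C) (e / 8)) => [|y].
  by rewrite lt_min !divr_gt0//; lra.
rewrite lt_min => /andP[xyr xye].
have -> : bend d b x - bend d b y = (code x - code y) +
    (damp (C * rdist x d) (b - code x) - damp (C * rdist y d) (b - code x)) +
    damp (C * rdist y d) (code y - code x).
  rewrite (_ : code y - code x = (b - code x) - (b - code y)).
    rewrite (dampB _ (b - code x)) /bend opprD addrACA -[RHS]addrA.
    congr (_ + _); by rewrite addrA subrK.
  by rewrite opprB [RHS]addrC addrA subrK.
have Cxy : `|C * rdist x d - C * rdist y d| < r.
  rewrite -mulrBr normrM gtr0_norm// mulrC -ltr_pdivlMr//.
  apply: le_lt_trans xyr; rewrite ler_norml.
  have := rdist_triangle x y d; have := rdist_triangle y x d.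
  by rewrite (rdistC y x); lra.
apply: (@le_trans _ _ (2 * rdist x y + e / 2 + 2 * rdist x y)); last by lra.
apply: le_trans (ler_normD _ _) _; apply: lerD.
  apply: le_trans (ler_normD _ _) _; apply: lerD; first exact: code_lip.
  exact: rP.
by rewrite (le_trans (damp_norm _ _))// (rdistC x y) code_lip.
Qed.
End bending.

(** * Choice of the targets by recursion on the rank *)

Lemma bijective_bending (L X B : Type) (d : L * nat -> X) (idx : X -> L * nat)
    (F : L * nat -> B -> X -> B) (E : B -> B -> Prop) (c : X -> B) :
  L -> cancel d idx ->
  (forall u v, E u v -> E v u) -> (forall u v w, E u v -> E v w -> E u w) ->
  (forall x y, E (c x) (c y) -> x = y) ->
  (forall i b, F i b (d i) = b) ->
  (forall b x, x <> d (idx x) -> E (F (idx x) b x) (c x)) ->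
  [set: B] #<= [set: L] ->
  [set: L] #<= [set y | forall x, ~ E y (c x)] ->
  (forall i, [set: L] #<= [set y | E y (c (d i))]) ->
  exists b : L * nat -> B, bijective (fun x => F (idx x) (b (idx x)) x).
Proof.
move=> l0 dK Esym Etrans c_inj Fd FE BL L0 LE.
(* [en S] enumerates [S] without repetition as soon as [S] has at least $|L|$ elements. *)
have /choice[en enP] (S : set B) : exists en : L -> B, [set: L] #<= S ->
    injective en /\ range en = S.
  have [LS|nLS] := pselect ([set: L] #<= S).
    have /card_eq_range[en ? ?] : [set: L] #= S.
      by rewrite card_eq_le LS (card_le_trans (card_leT S)).
    by exists en.
  have /card_leT_setP[f _ _] := L0; by exists f.
pose S0 := [set y | forall x, ~ E y (c x)].
(* These are the points with the tail of some [c x], with [idx x] of rank [n], that [x] itself does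
   not take as a non-centre. Only the targets of rank [n] enter, so the recursion on ranks is well
   founded. *)
pose S n (b : L -> B) := [set y | exists x, [/\ (idx x).2 = n, E y (c x) &
   x = d (idx x) \/ y <> F (idx x) (b (idx x).1) x]].
have LS n b : [set: L] #<= S n b.
  apply: card_le_trans (LE (l0, n)) (subset_card_le _) => y Ey.
  by exists (d (l0, n)); rewrite dK; split => //; left.
pose fix b n := if n is m.+1 then en (S m (b m)) else en S0.
have b_inj n : injective (b n) by case: n => [|n]; apply: (enP _ _).1.
have b0 : range (b 0%N) = S0 by apply: (enP _ _).2.
have bS n : range (b n.+1) = S n (b n) by apply: (enP _ _).2.
pose f x := F (idx x) (b (idx x).2 (idx x).1) x.
exists (fun i => b i.2 i.1); rewrite -/f.
have fd i : f (d i) = b i.2 i.1 by rewrite /f dK Fd.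
have fE x : x <> d (idx x) -> E (f x) (c x) by exact: FE.
(* The value at a non-centre [x] has the tail of [c x]. A target of rank 0 has no such tail, and one
   of positive rank with this tail was chosen different from that value. *)
have fd_neq i x : x <> d (idx x) -> f (d i) <> f x.
  move=> xd; rewrite fd => bx; have Ex := fE _ xd.
  have : range (b i.2) (f x) by exists i.1.
  move: (i.2) => [|n]; first by rewrite b0 => /(_ x).
  rewrite bS => -[y [yn Ey]].
  have xy : x = y by apply: c_inj; apply: Etrans Ey; exact: Esym.
  by rewrite -{}xy in yn *; rewrite -yn => -[].
have f_inj : injective f.
  move=> x y fxy; have [xd|xd] := pselect (x = d (idx x)); last first.
    have [yd|yd] := pselect (y = d (idx y)).
      by case: (fd_neq (idx y) x xd); rewrite -yd.
    by apply: c_inj; apply: Etrans (fE _ yd); rewrite -fxy; exact/Esym/fE.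
  have [yd|yd] := pselect (y = d (idx y)); last first.
    by case: (fd_neq (idx x) y yd); rewrite -xd.
  move: fxy; rewrite xd yd !fd; move: (idx x) (idx y) => [l n] [k m] /= lk.
  (* The tail of a target determines its rank: rank 0 means no code's tail, and otherwise the code
     with that tail is unique and its index has rank one less. *)
  suff nm : n = m by rewrite nm in lk *; rewrite (b_inj _ _ _ lk).
  have : range (b m) (b n l) by rewrite lk; exists k.
  have : range (b n) (b n l) by exists l.
  case: n m {lk} => [|n] [|m] //; rewrite ?b0 ?bS.
  - by move=> nE [z [_ Ez _]]; case: (nE z).
  - by move=> [z [_ Ez _]] nE; case: (nE z).
  - move=> [z [<- Ez _]] [w [<- Ew _]].
    by rewrite (_ : z = w)//; apply: c_inj; apply: Etrans Ew; exact: Esym.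
have f_surj y : exists x, f x = y.
  have b_surj n : range (b n) y -> exists x, f x = y.
    by move=> [l _ <-]; exists (d (l, n)); rewrite fd.
  have [nE|/existsNP[x /contrapT Ex]] := pselect (S0 y).
    by apply: (b_surj 0%N); rewrite b0.
  have [fxy|fxy] := pselect (x <> d (idx x) /\ y = f x).
    by exists x; rewrite fxy.2.
  apply: (b_surj (idx x).2.+1); rewrite bS; exists x; split=> //.
  by have [xd|xd] := pselect (x = d (idx x)); [left|right => yx; apply: fxy].
have [g gK] := choice f_surj; exists g => // x.
by apply: f_inj; rewrite gK.
Qed.

(** * Large families with prescribed tails *)

Section witnesses.
Context (R : realType) (X : metricType R).
Local Notation K := (nat * X)%type.

Lemma delta_vanishing (i : K) :
  (fun j : K => (j == i)%:R : R^o) \in @vanishing R K.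
Proof.
apply/asboolP => e e0; apply: sub_finite_set (finite_set1 i) => j /=.
by have [//|_] := eqVneq j i; rewrite normr0 leNgt e0.
Qed.

Definition delta (i : K) : c0 R K := C0 (delta_vanishing i).

Lemma deltaE i j : delta i j = (j == i)%:R :> R.
Proof. by []. Qed.

Lemma delta_separated i j : i <> j -> 1 <= `|delta i - delta j|.
Proof.
move=> /eqP ij; apply: le_trans (c0_normr_ge (delta i - delta j) i).
by rewrite c0B !deltaE eqxx (negbTE ij) subr0 normr1.
Qed.

(** Applied at level 0, where the perturbation leaves the tail unchanged, this puts at least $|X|$
    elements into a tail class. *)
Lemma addr_delta_inj (g : c0 R K) n : injective (fun s => g + delta (n, s)).
Proof.
move=> s t /addrI st; apply: contrapT => nst.
have /delta_separated : (n, s) <> (n, t) by move=> -[].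
by rewrite st subrr normr0 ler10.
Qed.

Lemma ladder_vanishing (s : X) :
  (fun i : K => 2 * i.1.+1%:R^-1 * (i.2 == s)%:R : R^o) \in @vanishing R K.
Proof.
apply/asboolP => e e0; have [|N Ne] := @invS_lt R (e / 2); first by lra.
apply: (sub_finite_set _ (finite_setX (finite_II N) (finite_set1 s))).
move=> -[n t] /=.
have [->|_] := eqVneq t s; last by rewrite mulr0 normr0 leNgt e0.
rewrite mulr1 ger0_norm ?mulr_ge0// => en; split=> //.
rewrite ltnNge; apply/negP => Nn.
have : n.+1%:R^-1 <= N.+1%:R^-1 :> R by rewrite lef_pV2 ?posrE// ler_nat.
by move: Ne en; set q : R := N.+1%:R^-1; set q' : R := n.+1%:R^-1; lra.
Qed.

Definition ladder (s : X) : c0 R K := C0 (ladder_vanishing s).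

(* At level [n] every code is at most [1/(n+1)], half the value of the ladder. *)
Lemma ladder_not_code s t x : ~ tail_eq (ladder s + delta (0%N, t)) (code x).
Proof.
move=> [N /(_ N.+1 s (leqnSn N)) lE]; have := code_le x N.+1 s.
rewrite -lE c0D deltaE xpair_eqE addr0 /= eqxx mulr1.
have : 0 < N.+2%:R^-1 :> R by rewrite invr_gt0.
by set q : R := N.+2%:R^-1; lra.
Qed.

Lemma code_delta_tail x t : tail_eq (code x + delta (0%N, t)) (code x).
Proof.
by exists 1%N => -[//|n] s _; rewrite c0D deltaE xpair_eqE addr0.
Qed.
End witnesses.

(** * Assembly and continuity of the bijection *)

Theorem corollary3p1 (R : realType) (L : Type)
    (L_infinite : infinite_set [set: L])
    (L_power : [set: L] #= [set: nat -> L])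
    (X : metricType R) (X_weight : has_weight X L) :
  exists (B : completeNormedModType R) (f : X -> B),
    [/\ has_weight B L, bijective f & continuous f].
Proof.
have L_pow : [set: nat -> L] #<= [set: L].
  by have := card_esym L_power; rewrite card_eq_le => /andP[].
have [phi _ phiT] := card_eq_range L_power.
have phi_surj u : exists a, phi a = u.
  by have [a _ <-] : range phi u by [rewrite phiT]; exists a.
have [l0 _] := infinite_setN0 L_infinite.
have [[Bs Bsb BsL] lowX] := X_weight.
have XL : [set: X] #<= [set: L].
  apply: card_le_weight Bsb _ L_pow.
  by move: BsL; rewrite card_eq_le => /andP[].
have [e [e0 [d0 d0_sep]]] := separated_weight phi_surj lowX.
have d0_inj : injective d0.
  move=> a b ab; apply: contrapT => /d0_sep; rewrite ab rdistxx; lra.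
have LX : [set: L] #<= [set: X] by apply/card_leTTP; exists d0.
have natL := card_le_nat L_infinite.
have /card_leTTP[pi pi_inj] : [set: L * nat] #<= [set: L].
  exact: (card_le_prod L_pow (card_leT [set: L]) natL).
have BL : [set: c0 R (nat * X)%type] #<= [set: L].
  apply: (@card_le_c0 L L_infinite L_pow R (nat * X)%type (0%N, d0 l0)).
  exact: (card_le_prod L_pow natL XL).
pose d i := d0 (pi i).
have d_sep i j : i <> j -> e <= rdist (d i) (d j).
  by move=> ij; apply: d0_sep => /pi_inj.
have e4 : 0 < e / 4 by lra.
(* At most one centre lies within [e / 4] of [x], as centres are [e] apart; when there is none, the
   index is arbitrary and the bend there is the code. *)
have /choice[idx idxP] x : exists i, forall j, rdist x (d j) < e / 4 -> i = j.
  have [[i xi]|/forallNP xN] := pselect (exists i, rdist x (d i) < e / 4);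
    last first.
    by exists (l0, 0%N) => j /xN.
  exists i => j xj; apply: contrapT => /d_sep.
  by have := rdist_triangle (d i) x (d j); rewrite (rdistC (d i) x); lra.
pose F i := bend (e / 4)^-1 (d i).
have C_gt0 : 0 < (e / 4)^-1 by rewrite invr_gt0.
have dK : cancel d idx by move=> i; apply: idxP; rewrite rdistxx.
have [||||||||b b_bij] := @bijective_bending L X (c0 R (nat * X)%type) d idx F
  (@tail_eq R X) (@code R X) l0 dK.
- exact: tail_eq_sym.
- exact: tail_eq_trans.
- exact: code_tail_inj.
- by move=> i b; exact: bend_center.
- by move=> b x; exact: bend_tail.
- exact: BL.
- apply: card_le_trans LX _; apply/card_leT_setP.
  exists (fun t => ladder (d0 l0) + delta (0%N, t)).
    exact: addr_delta_inj.
  by move=> t x; exact: ladder_not_code.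
- move=> i; apply: card_le_trans LX _; apply/card_leT_setP.
  exists (fun t => code (d i) + delta (0%N, t)); first exact: addr_delta_inj.
  by move=> t; exact: code_delta_tail.
exists (c0 R (nat * X)%type), (fun x => F (idx x) (b (idx x)) x); split => //.
  apply: (@has_weight_separated R _ L (fun a => delta (0%N, d0 a)) 1) => //.
    move=> x y xy; rewrite -ball_normE /=; apply/negP; rewrite -leNgt.
    by apply: delta_separated => -[/d0_inj].
  exact: (card_le_prod L_pow natL BL).
move=> x.
(* Near [x] a single bend suffices. If some [z] close to [x] is close to its centre, any other
   centre met near [x] would be joined to it by four distances below [e / 4], hence coincides with
   it; where no centre is near, all bends equal the code. *)
have [i xi] : exists i,
    \forall y \near x, F (idx y) (b (idx y)) y = F i (b i) y.
  have FE i y : rdist y (d i) < e / 4 -> idx y = i by exact: idxP.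
  have [[z [xz zd]]|nz] := pselect (exists z, rdist x z < e / 4 /\
      rdist z (d (idx z)) < e / 4).
    exists (idx z); apply/nbhs_rdistP; exists (e / 4) => // y xy.
    have [yd|yd] := ltP (rdist y (d (idx y))) (e / 4).
      suff -> : idx y = idx z by [].
      apply: contrapT => /d_sep.
      have := rdist_triangle (d (idx y)) y (d (idx z)).
      have := rdist_triangle y x (d (idx z)).
      have := rdist_triangle x z (d (idx z)).
      by rewrite (rdistC y x) (rdistC (d (idx y)) y); lra.
    have [yz|yz] := ltP (rdist y (d (idx z))) (e / 4).
      by rewrite (FE _ _ yz).
    by rewrite /F !bend_far ?invrK.
  exists (idx x); apply/nbhs_rdistP; exists (e / 4) => // y xy.
  have [yd|yd] := ltP (rdist y (d (idx y))) (e / 4).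
    by case: nz; exists y.
  have [yx|yx] := ltP (rdist y (d (idx x))) (e / 4).
    by rewrite (FE _ _ yx).
  by rewrite /F !bend_far ?invrK.
rewrite /continuous_at (nbhs_singleton xi).
apply: (cvg_trans _ (@bend_continuous R X _ C_gt0 (d i) (b i) x)).
by apply: near_eq_cvg; apply: filterS xi => y ->.
Qed.
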